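(* The following two assertions hold. $1^\circ$ Let $n\ge 1$ be an integer and let $a,a_1,\dots,a_n,b_1,\dots,b_n\in\mathbb{Z}_2$. The function $f\colon\mathbb{Z}_2\to\mathbb{Z}_2$ given by $$f(x)=a+\sum_{i=1}^{n}a_i\,(x\ \mathrm{XOR}\ b_i)$$ preserves measure if and only if it is bijective modulo $2$; and it is ergodic if and only if it is transitive modulo $4$. $2^\circ$ Let $a,a_0,a_1,a_2,\dots\in\mathbb{Z}_2$ and let $f\colon\mathbb{Z}_2\to\mathbb{Z}_2$ be a function of the form $$f(x)=a+\sum_{i=0}^{\infty}a_i\,\delta_i(x)\qquad(x\in\mathbb{Z}_2)$$ (the series converging in $\mathbb{Z}_2$ for every $x\in\mathbb{Z}_2$). Then $f$ is compatible and ergodic if and only if the following conditions hold simultaneously: $$a\equiv 1\pmod 2,\qquad a_0\equiv 1\pmod 4,\qquad \|a_i\|_2=2^{-i}\ \text{ for } i=1,2,3,\dots$$ Moreover, $f$ is compatible and measure preserving if and only if $$\|a_i\|_2=2^{-i}\quad\text{for all } i=0,1,2,3,\dots$$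
   Context: $\mathbb{Z}_2$ is the ring of $2$-adic integers with the $2$-adic norm $\|\cdot\|_2$ (so $\|2^k u\|_2=2^{-k}$ for a unit $u$). For $x\in\mathbb{Z}_2$, $\delta_i(x)\in\{0,1\}$ denotes the $i$-th binary digit of $x$, i.e. $x=\sum_{i\ge 0}\delta_i(x)2^i$. The operation $\mathrm{XOR}$ on $\mathbb{Z}_2$ is digitwise addition modulo 2: $\delta_j(x\ \mathrm{XOR}\ y)\equiv\delta_j(x)+\delta_j(y)\pmod 2$ for all $j$. A map $f\colon\mathbb{Z}_2\to\mathbb{Z}_2$ is called compatible if $u\equiv v\pmod{2^r}$ implies $f(u)\equiv f(v)\pmod{2^r}$ for all $u,v\in\mathbb{Z}_2$ and all $r\ge 1$ (equivalently, $\|f(u)-f(v)\|_2\le\|u-v\|_2$). A compatible $f$ induces a map $f\bmod 2^k$ of $\mathbb{Z}/2^k\mathbb{Z}$ into itself; $f$ is called bijective modulo $2^k$ if this induced map is a permutation, and transitive modulo $2^k$ if this induced map is a permutation with a single cycle (of length $2^k$). The function $f$ in assertion $1^\circ$ is compatible. $\mathbb{Z}_2$ is endowed with the normalized Haar measure $\mu$ (so $\mu(a+2^k\mathbb{Z}_2)=2^{-k}$). A measurable $f\colon\mathbb{Z}_2\to\mathbb{Z}_2$ preserves measure if $\mu(f^{-1}(S))=\mu(S)$ for every measurable $S$. A measure-preserving $f$ is ergodic if every measurable $S$ with $f^{-1}(S)=S$ has $\mu(S)\in\{0,1\}$. *)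

(* Defs.v *)
From HB Require Import structures.
From mathcomp Require Import all_boot all_order all_algebra all_fingroup.
From mathcomp Require Import all_classical all_reals all_analysis.
Set Implicit Arguments.
Unset Strict Implicit.
Unset Printing Implicit Defensive.
Import Order.TTheory GRing.Theory Num.Theory.
Import numFieldNormedType.Exports.

(* The inverse limit of the rings Z/2^kZ; residue x k is the representative
   in [0, 2^k) of x modulo 2^k. *)
Record Z2 := MkZ2 {
  residue : nat -> nat;
  residueP : forall k, residue k.+1 %% 2 ^ k = residue k }.

Lemma residue_lt x k : residue x k < 2 ^ k.
Proof. by rewrite -residueP ltn_pmod// expn_gt0. Qed.

Lemma residue_modl x k : residue x k %% 2 ^ k = residue x k.
Proof. exact: modn_small (residue_lt x k). Qed.

Lemma residue_mod x k m : k <= m -> residue x m %% 2 ^ k = residue x k.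
Proof.
move=> km; rewrite -(subnKC km); elim: (m - k) => [|j IH].
  by rewrite addn0 residue_modl.
rewrite addnS -IH -[in RHS]residueP modn_dvdm// dvdn_exp2l//.
exact: leq_addr.
Qed.

Lemma Z2_eq x y : residue x =1 residue y -> x = y.
Proof.
case: x y => [r p] [s q] /= /funext rs; move: p q; rewrite rs => p q.
by rewrite (Prop_irrelevance p q).
Qed.

HB.instance Definition _ := gen_eqMixin Z2.
HB.instance Definition _ := gen_choiceMixin Z2.

Lemma mod2S a k : a %% 2 ^ k.+1 %% 2 ^ k = a %% 2 ^ k.
Proof. by rewrite modn_dvdm// dvdn_exp2l. Qed.

Lemma Z2_nat_subproof n k : n %% 2 ^ k.+1 %% 2 ^ k = n %% 2 ^ k.
Proof. exact: mod2S. Qed.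
Definition Z2_nat n := MkZ2 (Z2_nat_subproof n).

Lemma Z2_add_subproof x y k :
  (residue x k.+1 + residue y k.+1) %% 2 ^ k.+1 %% 2 ^ k =
  (residue x k + residue y k) %% 2 ^ k.
Proof. by rewrite mod2S -modnDm !residueP. Qed.
Definition Z2_add x y := MkZ2 (Z2_add_subproof x y).

Lemma Z2_mul_subproof x y k :
  (residue x k.+1 * residue y k.+1) %% 2 ^ k.+1 %% 2 ^ k =
  (residue x k * residue y k) %% 2 ^ k.
Proof. by rewrite mod2S -modnMm !residueP. Qed.
Definition Z2_mul x y := MkZ2 (Z2_mul_subproof x y).

Lemma Z2_opp_subproof x k :
  (2 ^ k.+1 - residue x k.+1) %% 2 ^ k.+1 %% 2 ^ k =
  (2 ^ k - residue x k) %% 2 ^ k.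
Proof.
rewrite mod2S; apply/eqP; rewrite -(eqn_modDr (residue x k.+1)).
rewrite subnK ?(ltnW (residue_lt _ _))// -modnDmr residueP.
by rewrite subnK ?(ltnW (residue_lt _ _))// modnn expnS modnMl.
Qed.
Definition Z2_opp x := MkZ2 (Z2_opp_subproof x).

Lemma Z2_addA : associative Z2_add.
Proof. by move=> x y z; apply: Z2_eq => k /=; rewrite modnDml modnDmr addnA. Qed.
Lemma Z2_addC : commutative Z2_add.
Proof. by move=> x y; apply: Z2_eq => k /=; rewrite addnC. Qed.
Lemma Z2_add0 : left_id (Z2_nat 0) Z2_add.
Proof. by move=> x; apply: Z2_eq => k /=; rewrite mod0n residue_modl. Qed.
Lemma Z2_addN : left_inverse (Z2_nat 0) Z2_opp Z2_add.
Proof.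
move=> x; apply: Z2_eq => k /=.
by rewrite modnDml subnK ?(ltnW (residue_lt _ _))// modnn mod0n.
Qed.
Lemma Z2_mulA : associative Z2_mul.
Proof. by move=> x y z; apply: Z2_eq => k /=; rewrite modnMml modnMmr mulnA. Qed.
Lemma Z2_mulC : commutative Z2_mul.
Proof. by move=> x y; apply: Z2_eq => k /=; rewrite mulnC. Qed.
Lemma Z2_mul1 : left_id (Z2_nat 1) Z2_mul.
Proof. by move=> x; apply: Z2_eq => k /=; rewrite modnMml mul1n residue_modl. Qed.
Lemma Z2_mulDl : left_distributive Z2_mul Z2_add.
Proof.
by move=> x y z; apply: Z2_eq => k /=; rewrite modnMml modnDm mulnDl.
Qed.

HB.instance Definition _ :=
  GRing.isZmodule.Build Z2 Z2_addA Z2_addC Z2_add0 Z2_addN.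

Lemma Z2_one_neq0 : Z2_nat 1 != 0%R.
Proof. by apply/eqP => /(congr1 (residue^~ 1)). Qed.

HB.instance Definition _ := GRing.Zmodule_isComNzRing.Build Z2
  Z2_mulA Z2_mulC Z2_mul1 Z2_mulDl Z2_one_neq0.
HB.instance Definition _ := isPointed.Build Z2 0%R.

Local Open Scope classical_set_scope.
Local Open Scope ring_scope.

Lemma residueD (x y : Z2) k :
  residue (x + y) k = ((residue x k + residue y k) %% 2 ^ k)%N.
Proof. by []. Qed.

Lemma residueM (x y : Z2) k :
  residue (x * y) k = ((residue x k * residue y k) %% 2 ^ k)%N.
Proof. by []. Qed.

Lemma residue_nat n k : residue n%:R k = (n %% 2 ^ k)%N.
Proof.
elim: n => [//|n IH]; rewrite -addn1 natrD residueD IH modnDml.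
by rewrite -[in RHS]modnDmr.
Qed.

Lemma residue_X2 r k : residue (2%:R ^+ r) k = (2 ^ r %% 2 ^ k)%N.
Proof. by rewrite -natrX residue_nat. Qed.

Definition eqmod (r : nat) (u v : Z2) : Prop :=
  exists w : Z2, u - v = 2%:R ^+ r * w.

Lemma Z2_shift_subproof x r k :
  ((residue x (k.+1 + r) %/ 2 ^ r) %% 2 ^ k = residue x (k + r) %/ 2 ^ r)%N.
Proof.
rewrite -(@residue_mod x (k + r) (k.+1 + r)) ?leq_add2r//.
set a := residue x _; rewrite {2}(divn_eq a (2 ^ (k + r))).
rewrite modnMDl modn_mod; apply/eqP.
rewrite {1}(divn_eq a (2 ^ (k + r))) expnD mulnA divnMDl ?expn_gt0//.
rewrite modnMDl modn_small// ltn_divLR ?expn_gt0// -expnD.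
by rewrite ltn_pmod// expn_gt0.
Qed.
Definition Z2_shift x r := MkZ2 (Z2_shift_subproof x r).

Lemma dvd2P (x : Z2) r :
  (exists w, x = 2%:R ^+ r * w) <-> residue x r = 0%N.
Proof.
split=> [[w ->]|x0]; first by rewrite residueM residue_X2 modnn mul0n mod0n.
exists (Z2_shift x r); apply: Z2_eq => k.
rewrite residueM residue_X2 modnMml /=.
have /dvdnP[q xq] : (2 ^ r %| residue x (k + r))%N.
  by rewrite /dvdn residue_mod ?leq_addl// x0.
by rewrite xq mulnK ?expn_gt0// mulnC -xq residue_mod// leq_addr.
Qed.

Lemma eqmodE r u v : eqmod r u v <-> residue u r = residue v r.
Proof.
rewrite /eqmod dvd2P; split=> [uv0|uv].
  by rewrite -[u](subrK v) residueD uv0 add0n residue_modl.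
by rewrite residueD uv -residueD subrr /= mod0n.
Qed.

Lemma eqmod_le k m u v : (k <= m)%N -> eqmod m u v -> eqmod k u v.
Proof.
move=> km /eqmodE uv; apply/eqmodE.
by rewrite -(residue_mod u km) uv residue_mod.
Qed.

Definition delta (i : nat) (x : Z2) : bool := odd (residue x i.+1 %/ 2 ^ i).

Lemma digit_sum_lt (d : nat -> bool) k : (\sum_(i < k) d i * 2 ^ i < 2 ^ k)%N.
Proof.
elim: k => [|k IH]; first by rewrite big_ord0.
rewrite big_ord_recr/= expnS mul2n -addnn -addSn leq_add//.
by case: (d k); rewrite ?mul1n ?mul0n.
Qed.

Lemma Z2_of_digits_subproof (d : nat -> bool) k :
  ((\sum_(i < k.+1) d i * 2 ^ i) %% 2 ^ k = \sum_(i < k) d i * 2 ^ i)%N.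
Proof. by rewrite big_ord_recr/= addnC modnMDl modn_small// digit_sum_lt. Qed.

(* The 2-adic integer with digits d 0, d 1, d 2, ... *)
Definition Z2_of_digits (d : nat -> bool) := MkZ2 (Z2_of_digits_subproof d).

Lemma delta_of_digits d i : delta i (Z2_of_digits d) = d i.
Proof.
rewrite /delta /= big_ord_recr/= addnC divnMDl ?expn_gt0//.
by rewrite divn_small ?digit_sum_lt// addn0 oddb.
Qed.

Lemma residue_digits x k : residue x k = (\sum_(i < k) delta i x * 2 ^ i)%N.
Proof.
elim: k => [|k IH].
  by rewrite big_ord0; apply/eqP; rewrite -leqn0 -ltnS residue_lt.
rewrite big_ord_recr/= -IH /delta.
have : (residue x k.+1 %/ 2 ^ k < 2)%N.
  by rewrite ltn_divLR ?expn_gt0// -expnS residue_lt.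
move=> q2; rewrite [LHS](divn_eq _ (2 ^ k)) residueP addnC.
by case: (residue x k.+1 %/ 2 ^ k)%N q2 => [|[|]].
Qed.

Lemma digitsK x : Z2_of_digits (delta^~ x) = x.
Proof. by apply: Z2_eq => k; rewrite [RHS]residue_digits. Qed.

Definition xor2 (x y : Z2) : Z2 :=
  Z2_of_digits (fun j => delta j x (+) delta j y).

Lemma delta_xor2 j x y : delta j (xor2 x y) = delta j x (+) delta j y.
Proof. exact: delta_of_digits. Qed.

(* The exponent of a nonzero x is the index of its first nonzero digit. *)
Definition norm2 (R : realType) (x : Z2) : R :=
  if pselect (exists i, delta i x) is left x_neq0
  then 2%:R ^- ex_minn x_neq0 else 0.
Arguments norm2 : clear implicits.

Lemma norm2_0 (R : realType) : norm2 R 0 = 0.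
Proof.
rewrite /norm2; case: pselect => // e; case: {-}(e) => i.
by rewrite {1}/delta /= mod0n div0n.
Qed.

Lemma norm2_unit (R : realType) k (u : Z2) :
  (exists v, u * v = 1) -> norm2 R (2%:R ^+ k * u) = 2%:R ^- k.
Proof.
move=> [v uv1]; have u1 : residue u 1 = 1%N.
  have /(congr1 (residue^~ 1%N)) := uv1; rewrite residueM.
  by case: (residue u 1%N) (residue_lt u 1%N) => [|[|]].
set x := _ * u.
have x0 : residue x k = 0%N by apply/dvd2P; exists u.
have xS : residue x k.+1 = (2 ^ k)%N.
  rewrite residueM residue_X2 modnMml expnS [(2 * _)%N]mulnC -muln_modr.
  by rewrite -[2%N]expn1 residue_mod// u1 muln1.
have dk : delta k x by rewrite /delta xS divnn expn_gt0.
rewrite /norm2; case: pselect => [e|[]]; last by exists k.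
case: ex_minnP => m dm mmin; congr (_ ^- _).
apply/eqP; rewrite eqn_leq mmin// leqNgt; apply/negP => mk.
by move: dm; rewrite /delta -(@residue_mod x m.+1 k)// x0 mod0n div0n.
Qed.

Definition compatible (f : Z2 -> Z2) : Prop :=
  forall (r : nat) (u v : Z2), (1 <= r)%N -> eqmod r u v -> eqmod r (f u) (f v).

Definition reduce (k : nat) (x : Z2) : 'I_(2 ^ k) := Ordinal (residue_lt x k).

(* f mod 2^k, computed on the representatives 0, ..., 2^k - 1 of Z/2^kZ. *)
Definition induced_map (k : nat) (f : Z2 -> Z2) (i : 'I_(2 ^ k)) : 'I_(2 ^ k) :=
  reduce k (f (i : nat)%:R).

Lemma induced_reduce k f x : (1 <= k)%N -> compatible f ->
  induced_map f (reduce k x) = reduce k (f x).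
Proof.
move=> k1 cf; apply/val_inj => /=; apply/eqmodE/cf => //.
by apply/eqmodE; rewrite residue_nat residue_modl.
Qed.

Definition bijective_mod (k : nat) (f : Z2 -> Z2) : Prop :=
  bijective (@induced_map k f).

Definition transitive_mod (k : nat) (f : Z2 -> Z2) : Prop :=
  exists2 s : {perm 'I_(2 ^ k)}, s =1 @induced_map k f & #|porbits s| = 1%N.

Lemma compatible_xor_sum n (a : Z2) (a_ b_ : 'I_n -> Z2) :
  compatible (fun x => a + \sum_(i < n) a_ i * xor2 x (b_ i)).
Proof.
move=> r u v _ /eqmodE uv; apply/eqmodE; rewrite !residueD; congr ((_ + _) %% _)%N.
apply: (big_ind2 (fun x y => residue x r = residue y r)) => //.
  by move=> x x' y y' xx' yy'; rewrite !residueD xx' yy'.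
move=> i _; rewrite !residueM; congr ((_ * _) %% _)%N.
apply: eq_bigr => j _; rewrite /delta.
by rewrite -(@residue_mod u j.+1 r)// uv residue_mod.
Qed.

Definition Z2_open (A : set Z2) : Prop :=
  forall x, A x -> exists k, forall y, eqmod k y x -> A y.

Lemma Z2_openT : Z2_open setT.
Proof. by move=> x _; exists 0%N. Qed.

Lemma Z2_openI : setI_closed Z2_open.
Proof.
move=> A B oA oB x [/oA[k Ak] /oB[l Bl]]; exists (maxn k l) => y yx.
by split; [apply: Ak|apply: Bl]; apply: eqmod_le yx; rewrite ?leq_maxl ?leq_maxr.
Qed.

Lemma Z2_open_bigcup (I : Type) (A : I -> set Z2) :
  (forall i, Z2_open (A i)) -> Z2_open (\bigcup_i A i).
Proof.
by move=> oA x [i _ /oA[k Ak]]; exists k => y /Ak; exists i.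
Qed.

HB.instance Definition _ :=
  isOpenTopological.Build Z2 Z2_openT Z2_openI Z2_open_bigcup.

HB.instance Definition _ := Measurable.copy Z2
  (@g_sigma_algebraType Z2 (@open Z2) : measurableType _).

Definition is_haar (R : realType) (mu : probability Z2 R) : Prop :=
  forall (a : Z2) (S : set Z2), measurable S ->
    mu [set a + x | x in S] = mu S.

Definition measure_preserving (R : realType) (mu : probability Z2 R)
    (f : Z2 -> Z2) : Prop :=
  measurable_fun setT f /\
  forall S : set Z2, measurable S -> mu (f @^-1` S) = mu S.

Definition ergodic (R : realType) (mu : probability Z2 R)
    (f : Z2 -> Z2) : Prop :=
  measure_preserving mu f /\
  forall S : set Z2, measurable S -> f @^-1` S = S ->
    mu S = 0%E \/ mu S = 1%E.

Lemma Z2_openE (A : set Z2) : open A <-> Z2_open A.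
Proof.
rewrite openE; split=> oA x Ax; last by exists A; split.
have [B [oB Bx BA]] := oA _ Ax; have [k Bk] := oB _ Bx.
by exists k => y /Bk /BA.
Qed.

Definition residue_class (k : nat) (x : Z2) : set Z2 := [set y | eqmod k y x].

Lemma residue_class0 x : residue_class 0 x = setT.
Proof.
apply/seteqP; split=> // y _; apply/eqmodE; apply/eqP.
by rewrite -(residue_modl y) -(residue_modl x) expn0 !modn1.
Qed.

Lemma measurable_residue_class k x : measurable (residue_class k x).
Proof.
apply: sub_sigma_algebra; apply/Z2_openE => y /eqmodE yx; exists k => z /eqmodE zy.
by apply/eqmodE; rewrite zy.
Qed.

Lemma open_residue_classes (A : set Z2) : open A ->
  A = \bigcup_(p in [set p : nat * nat | residue_class p.1 p.2%:R `<=` A])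
        residue_class p.1 p.2%:R.
Proof.
move=> /Z2_openE oA; apply/seteqP; split=> [x /oA[k Ak]|x [p]]; last exact.
exists (k, residue x k) => /=; last first.
  by apply/eqmodE; rewrite residue_nat residue_modl.
by move=> y /eqmodE yx; apply/Ak/eqmodE; rewrite yx residue_nat residue_modl.
Qed.

Definition residue_classes : set_system Z2 :=
  [set A | A = set0 \/ exists k x, A = residue_class k x].

Lemma residue_classesI : setI_closed residue_classes.
Proof.
have sub k l x y z : (k <= l)%N -> eqmod k z x -> eqmod l z y ->
    residue_class k x `&` residue_class l y = residue_class l y.
  move=> kl zx zy; apply/setIidPr => t ty; apply/eqmodE.
  move/(eqmod_le kl)/eqmodE : ty; move/(eqmod_le kl)/eqmodE : zy.
  by move/eqmodE : zx => -> ->.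
move=> A B [->|[k [x ->]]] [->|[l [y ->]]].
- by left; rewrite set0I.
- by left; rewrite set0I.
- by left; rewrite setI0.
have [->|/set0P[z [zx zy]]] := eqVneq (residue_class k x `&` residue_class l y) set0.
  by left.
right; have [kl|/ltnW lk] := leqP k l.
  by exists l, y; exact: (sub _ _ _ _ z).
by exists k, x; rewrite setIC; exact: (sub _ _ _ _ z).
Qed.

Lemma Z2_measurableE : @measurable _ Z2 = <<s residue_classes >>.
Proof.
apply/seteqP; split.
  apply: smallest_sub; first exact: smallest_sigma_algebra.
  move=> A /open_residue_classes ->.
  have -> : <<s residue_classes >> =
    @measurable _ (@g_sigma_algebraType Z2 residue_classes) by [].
  rewrite bigcup_mkcond; apply: countable_bigcupT_measurable => // p.
  case: ifPn => _; last exact: measurable0.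
  by apply: sub_sigma_algebra; right; exists p.1, p.2%:R.
apply: smallest_sub; first exact: smallest_sigma_algebra.
move=> A [->|[k [x ->]]]; first exact: measurable0.
exact: measurable_residue_class.
Qed.

Lemma measurable_fun_Z2 d (T : measurableType d) (f : T -> Z2) :
  (forall k x, measurable (f @^-1` residue_class k x)) -> measurable_fun setT f.
Proof.
move=> mf; have -> : measurable_fun setT f =
  measurable_fun setT (f : T -> @g_sigma_algebraType Z2 residue_classes).
  by rewrite /measurable_fun Z2_measurableE.
apply: measurability => // _ [_ [->|[k [x ->]]] <-]; rewrite setTI.
  by rewrite preimage_set0.
exact: mf.
Qed.

Lemma eqmodS k (x y : Z2) :
  eqmod k.+1 x y <-> eqmod k x y /\ delta k x = delta k y.
Proof.
split=> [xy|[/eqmodE xy d]].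
  split; first exact: eqmod_le xy.
  by move/eqmodE : xy => xy; rewrite /delta xy.
apply/eqmodE; rewrite !residue_digits !big_ord_recr/=.
by rewrite -!residue_digits xy d.
Qed.

Section haar_existence.
Variable R : realType.

Let unit_itv : set R := `[0, 1[.

Let bits (t : R) (i : nat) := odd (Num.truncn (2%:R ^+ i.+1 * t)).

Let to_Z2 (t : R) : Z2 := if t \in unit_itv then Z2_of_digits (bits t) else 0.

Let prefix (x : Z2) := fix m (k : nat) : nat :=
  if k is j.+1 then ((m j).*2 + delta j x)%N else 0%N.

Let prefix_lt x k : (prefix x k < 2 ^ k)%N.
Proof.
elim: k => [//|k IH] /=; rewrite expnS mul2n.
by case: (delta k x); rewrite ?addn1 ?addn0 ?ltn_Sdouble ?ltn_double.
Qed.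

Let truncn_half (t : R) k : 0 <= t ->
  (Num.truncn (2%:R ^+ k.+1 * t))./2 = Num.truncn (2%:R ^+ k * t).
Proof.
move=> t0; set a := 2%:R ^+ k * t.
have a0 : 0 <= a by rewrite mulr_ge0// exprn_ge0.
rewrite exprS -mulrA -/a; apply/esym/eqP; rewrite truncn_eq//.
set n := Num.truncn _.
have /truncn_itv : 0 <= 2%:R * a by rewrite mulr_ge0.
rewrite -/n => /andP[na an].
have two0 : 0 < 2%:R :> R by [].
apply/andP; split.
  rewrite -(ler_pM2l two0) (le_trans _ na)// -natrM ler_nat mul2n.
  by rewrite -[leqRHS]odd_double_half leq_addl.
rewrite -(ltr_pM2l two0) (lt_le_trans an)// -natrM ler_nat mul2n doubleS.
by rewrite -[in leqLHS](odd_double_half n); case: (odd n).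
Qed.

Let prefixP (t : R) x k : 0 <= t < 1 ->
  eqmod k (Z2_of_digits (bits t)) x <->
  Num.truncn (2%:R ^+ k * t) = prefix x k.
Proof.
move=> /andP[t0 t1]; elim: k => [|k IH].
  rewrite expr0 mul1r /=; split => _; last first.
    by have : residue_class 0 x (Z2_of_digits (bits t)) by rewrite residue_class0.
  by apply/eqP; rewrite truncn_eq// t0 t1.
rewrite eqmodS IH delta_of_digits /bits -(truncn_half _ t0) /=.
set n := Num.truncn _.
split=> [[<- <-]|]; first by rewrite addnC odd_double_half.
by move=> ->; case: (delta k x);
  rewrite ?addn1 ?addn0 /= odd_double ?uphalf_double ?doubleK.
Qed.

Let to_Z2_preimage x k : unit_itv `&` (to_Z2 @^-1` residue_class k x) =
  `[(prefix x k)%:R / 2%:R ^+ k, (prefix x k).+1%:R / 2%:R ^+ k[%classic.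
Proof.
have p0 : 0 < 2%:R ^+ k :> R by rewrite exprn_gt0.
apply/seteqP; split=> t /=.
  move=> [t01]; rewrite /to_Z2 mem_set// /residue_class/=.
  move: t01; rewrite /unit_itv /= !in_itv/= => t01 /(prefixP _ _ t01)/eqP.
  have /andP[t0 _] := t01.
  rewrite truncn_eq; last by rewrite mulr_ge0// ltW.
  by rewrite ler_pdivrMr// ltr_pdivlMr// [t * _]mulrC.
rewrite in_itv/= ler_pdivrMr// ltr_pdivlMr// ![t * _]mulrC => tk.
have t01 : 0 <= t < 1.
  have /andP[a b] := tk; apply/andP; split.
    by rewrite -(pmulr_rge0 _ p0) (le_trans _ a).
  rewrite -(ltr_pM2l p0) mulr1 (lt_le_trans b)// -natrX ler_nat.
  exact: prefix_lt.
have tu : unit_itv t by rewrite /unit_itv /= in_itv.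
split=> //; rewrite /to_Z2 mem_set//; apply/prefixP => //.
apply/eqP; rewrite truncn_eq//; have /andP[t0 _] := t01.
by rewrite mulr_ge0// ltW.
Qed.

Let measurable_unit_itv : measurable unit_itv.
Proof. exact: measurable_itv. Qed.

Let measurable_to_Z2 : measurable_fun setT (to_Z2 : measurableTypeR R -> Z2).
Proof.
apply: measurable_fun_Z2 => k x.
rewrite -[X in measurable X](setUIDK _ unit_itv); apply: measurableU.
  by rewrite setIC to_Z2_preimage; exact: measurable_itv.
have [x0|x0] := pselect (residue_class k x 0); last first.
  rewrite [X in measurable X](_ : _ = set0)// -subset0 => t [+ tu].
  by rewrite /= /to_Z2 memNset// => /x0.
rewrite [X in measurable X](_ : _ = ~` unit_itv); first exact: measurableC.
apply/seteqP; split=> t; first by case.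
by move=> tu; split=> //; rewrite /= /to_Z2 memNset.
Qed.

Definition unit_lebesgue := mrestr (@lebesgue_measure R) measurable_unit_itv.
HB.instance Definition _ := Measure.on unit_lebesgue.

(* The law of \sum_i d_i 2^i, for the binary expansion 0.d_0d_1d_2... of a
   uniform random point of [0, 1). *)
Definition haar_measure :=
  pushforward unit_lebesgue (to_Z2 : measurableTypeR R -> Z2).

Let haar_measure0 : haar_measure set0 = 0%E.
Proof. by rewrite /haar_measure /pushforward preimage_set0 measure0. Qed.

Let haar_measure_ge0 A : (0 <= haar_measure A)%E.
Proof. exact: measure_ge0. Qed.

Let haar_measure_sigma_additive : semi_sigma_additive haar_measure.
Proof. exact: measure_semi_sigma_additive. Qed.

HB.instance Definition _ := isMeasure.Build _ _ _ haar_measure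
  haar_measure0 haar_measure_ge0 haar_measure_sigma_additive.

Lemma haar_measure_residue_class k x :
  haar_measure (residue_class k x) = (2%:R ^- k)%:E.
Proof.
rewrite /haar_measure /pushforward /unit_lebesgue /mrestr setIC to_Z2_preimage.
rewrite lebesgue_measure_itv/= lte_fin ltr_pM2r ?invr_gt0 ?exprn_gt0//.
by rewrite ltr_nat ltnSn -EFinB -mulrBl -natrB// subSnn mul1r.
Qed.

Let haar_measure_setT : haar_measure setT = 1%E.
Proof.
by rewrite -(residue_class0 0) haar_measure_residue_class expr0 invr1.
Qed.

HB.instance Definition _ := Measure_isProbability.Build _ _ _
  haar_measure haar_measure_setT.

Lemma haar_exists : exists mu : probability Z2 R, is_haar mu.
Proof.
exists haar_measure => a S mS.
have mB : measurable_fun setT (fun x : Z2 => x - a).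
  apply: measurable_fun_Z2 => k x.
  rewrite [X in measurable X](_ : _ = residue_class k (x + a)).
    exact: measurable_residue_class.
  by apply/seteqP; split=> y [w yx]; exists w; rewrite -yx opprD addrA addrAC.
have -> : [set a + x | x in S] = (fun x => x - a) @^-1` S.
  apply/seteqP; split=> [_ [x Sx <-]|x Sx] /=; first by rewrite addrC addKr.
  by exists (x - a) => //; rewrite addrC subrK.
pose B : {mfun Z2 >-> Z2} := HB.pack (fun x : Z2 => x - a)
  (isMeasurableFun.Build _ _ _ _ _ mB).
apply: (measure_unique residue_classes (fun=> setT) _ _ _ _
  (distribution haar_measure B) haar_measure) => //.
- exact: Z2_measurableE.
- exact: residue_classesI.
- by move=> _; right; exists 0%N, 0; rewrite residue_class0.
- by rewrite bigcup_const.
- move=> A [->|[k [x ->]]]; first by rewrite !measure0.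
  have BE : B @^-1` residue_class k x = residue_class k (x + a).
    by apply/seteqP; split=> y [w yx]; exists w; rewrite -yx /= opprD addrA addrAC.
  transitivity (haar_measure (B @^-1` residue_class k x)); first by [].
  rewrite BE.
  exact: etrans (haar_measure_residue_class _ _)
    (esym (haar_measure_residue_class _ _)).
- by move=> _; apply: (@le_lt_trans _ _ 1%E); [exact: (@probability_le1 _ _ _
    (distribution haar_measure B))|exact: ltry].
Qed.

End haar_existence.

(* Main.v *)
Require Import Defs.
From HB Require Import structures.
From mathcomp Require Import all_boot all_order all_algebra all_fingroup.
From mathcomp Require Import all_classical all_reals all_analysis.
From mathcomp Require Import ring.
Import Order.TTheory GRing.Theory Num.Theory.
Import numFieldNormedType.Exports.
Import Defs.
Local Open Scope classical_set_scope.
Local Open Scope ring_scope.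

Set Implicit Arguments.
Unset Strict Implicit.
Unset Printing Implicit Defensive.

(** Everything reduces to congruences. The condition [norm2 (a_ i) = 2^-i]
    says that [a_ i = 2^i] modulo [2^(i+1)] ([norm2P]), and a compatible map
    is studied through its reductions modulo [2^k].

    _From maps to dynamics._ Haar measure gives mass [2^-k] to each class
    modulo [2^k]. A compatible measure preserving map hits every class, so it
    is bijective modulo [2^k]; if it is ergodic, the union of the classes in
    one cycle modulo [2^k] is invariant of positive measure, so there is only
    one cycle. Conversely, let [f] be an isometry: the preimage of a class is
    a single class, so [f] preserves the measure. If moreover the orbit of [0]
    meets every class, then an invariant [S] occupies the same mass in all
    classes modulo [2^k]; by uniqueness of Haar measure,
    [mu (A `&` S) = mu S * mu A] for every [A], and [A := S] gives
    [mu S = mu S ^ 2].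

    _From coefficients to isometries._ Let [f x = a + \sum_i a_ i * delta i x].
    Since [a_ j = f (2^j) - f 0], compatibility and injectivity modulo
    [2^(j+1)] force [a_ j = 2^j] modulo [2^(j+1)]. Conversely these congruences
    give the drift formula ([digit_series_drift])
    [f x = x + a + \sum_(i < k) (a_ i - 2^i) * delta i x] modulo [2^(k+1)],
    in which the increment depends on [x] modulo [2^k] only: [f] is an
    isometry. Adding up the drift along the orbit [x_ t] of [0],
    [x_ (2^k) = 2^k * a + \sum_(i < k) (a_ i - 2^i) * N_ i], where [N_ i] counts
    the [t < 2^k] for which digit [i] of [x_ t] is set. The claim is that
    [x_ (2^k) = 2^k] modulo [2^(k+1)]: the cycle modulo [2^k] lifts to a single
    cycle of double length ([digit_series_orbit_period]). If it holds for all
    smaller exponents, digits are balanced, that is [N_ i = 2^(k-1)]; if also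
    [a_ 0 = 1] modulo [4], all the [a_ i - 2^i] are multiples of [4], so the sum
    vanishes modulo [2^(k+1)], and the claim for [k] follows as [a] is odd. The
    same formula at [t = 1] and [t = 2] shows that transitivity modulo [4]
    requires both congruences ([orbit_mod4_coefs]).

    _From xor to digit series._ Digitwise,
    [x xor b = b + \sum_j 2^j * (1 - 2 * delta j b) * delta j x], so the maps of
    the first assertion are digit series whose [j]-th coefficient is [2^j]
    times a number congruent modulo [2] to [\sum_i a_ i], whatever [j] is:
    bijectivity modulo [2] controls all the coefficients at once. *)

(** * Congruences and digits *)

Lemma eqmod_refl k u : eqmod k u u.
Proof. exact/eqmodE. Qed.

Lemma eqmod_sym k u v : eqmod k u v -> eqmod k v u.
Proof. by move=> /eqmodE uv; apply/eqmodE. Qed.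

Lemma eqmod_trans k v u w : eqmod k u v -> eqmod k v w -> eqmod k u w.
Proof. by move=> /eqmodE uv /eqmodE vw; apply/eqmodE; rewrite uv. Qed.

Lemma eqmod0 u v : eqmod 0 u v.
Proof. by exists (u - v); rewrite mul1r. Qed.

Lemma eqmodD k u v u' v' :
  eqmod k u v -> eqmod k u' v' -> eqmod k (u + u') (v + v').
Proof.
by move=> [w e] [w' e']; exists (w + w'); rewrite mulrDr -e -e'; ring.
Qed.

Lemma eqmodN k u v : eqmod k u v -> eqmod k (- u) (- v).
Proof. by move=> [w e]; exists (- w); rewrite mulrN -e; ring. Qed.

Lemma eqmodB k u v u' v' :
  eqmod k u v -> eqmod k u' v' -> eqmod k (u - u') (v - v').
Proof. by move=> uv /eqmodN; exact: eqmodD. Qed.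

Lemma eqmodMl k c u v : eqmod k u v -> eqmod k (c * u) (c * v).
Proof. by move=> [w e]; exists (c * w); rewrite mulrCA -e; ring. Qed.

Lemma eqmodMr k c u v : eqmod k u v -> eqmod k (u * c) (v * c).
Proof. by rewrite ![_ * c]mulrC; exact: eqmodMl. Qed.

Lemma eqmod_mulX2 m k u v :
  eqmod k u v -> eqmod (m + k) (2%:R ^+ m * u) (2%:R ^+ m * v).
Proof. by move=> [w e]; exists w; rewrite exprD -mulrA -e mulrBr. Qed.

Lemma eqmod_sum k (I : Type) (r : seq I) (P : pred I) (F G : I -> Z2) :
  (forall i, P i -> eqmod k (F i) (G i)) ->
  eqmod k (\sum_(i <- r | P i) F i) (\sum_(i <- r | P i) G i).
Proof.
move=> FG; apply: (big_ind2 (eqmod k)) => //; first exact: eqmod_refl.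
by move=> *; exact: eqmodD.
Qed.

Lemma eqmod_subr0 k u v : eqmod k (u - v) 0 <-> eqmod k u v.
Proof. by rewrite /eqmod subr0. Qed.

Lemma eqmod_natX k : eqmod k (2%:R ^+ k) 0.
Proof. by exists 1; rewrite subr0 mulr1. Qed.

Lemma neqmodX2 k : ~ eqmod k.+1 (2%:R ^+ k) 0.
Proof.
move=> /eqmodE; rewrite residue_X2 -[0]/(0%:R) residue_nat mod0n.
rewrite modn_small ?ltn_exp2l//.
by move/eqP; rewrite expn_eq0.
Qed.

Lemma eqmodS_cases k u v :
  eqmod k u v -> eqmod k.+1 u v \/ eqmod k.+1 u (v + 2%:R ^+ k).
Proof.
move=> [w e]; have [w0|w1] : eqmod 1 w 0 \/ eqmod 1 w 1.
  rewrite !eqmodE -[0]/(0%:R) -[1]/(1%:R) !residue_nat.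
  by case: (residue w 1) (residue_lt w 1) => [|[|]] //; [left|right].
- left; apply/eqmod_subr0; rewrite e -addn1 -(mulr0 (2%:R ^+ k)).
  exact: eqmod_mulX2.
- right; apply/eqmod_subr0; rewrite opprD addrA e -addn1.
  by apply/eqmod_subr0; rewrite -[X in eqmod _ _ X]mulr1; exact: eqmod_mulX2.
Qed.

Lemma eqmod_delta k i u v : (i < k)%N -> eqmod k u v -> delta i u = delta i v.
Proof. by move=> ik /(eqmod_le ik)/eqmodE uv; rewrite /delta uv. Qed.

Lemma eqmod_digits k x :
  eqmod k x (\sum_(0 <= i < k) 2%:R ^+ i * (delta i x)%:R).
Proof.
rewrite [X in eqmod _ _ X](_ : _ = (residue x k)%:R).
  by apply/eqmodE; rewrite residue_nat residue_modl.
rewrite residue_digits natr_sum big_mkord; apply: eq_bigr => i _.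
by rewrite natrM natrX mulrC.
Qed.

(** [norm2 x = 2^-i] means that digit [i] is the first nonzero digit of [x],
    and a congruence modulo [2^(i+1)] sees exactly the digits up to [i]. *)
Lemma norm2P (R : realType) i x :
  norm2 R x = 2%:R ^- i <-> eqmod i.+1 x (2%:R ^+ i).
Proof.
have low (j : nat) : ((forall m, (m < j)%N -> ~~ delta m x) <-> eqmod j x 0).
  split=> [x0|x0 m mj].
    apply: eqmod_trans (eqmod_digits j x) _; rewrite big_nat big1 => [|m].
      exact: eqmod_refl.
    by move=> /andP[_ /x0/negbTE ->]; rewrite mulr0.
  by rewrite (eqmod_delta mj x0) /delta /= mod0n div0n.
split=> [|xi].
  rewrite /norm2; case: pselect => [e|_ /esym/eqP]; last first.
    by rewrite invr_eq0 expf_eq0/= pnatr_eq0 andbF.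
  case: ex_minnP => m dm mmin /invr_inj; rewrite -!natrX => /eqP.
  rewrite eqr_nat eqn_exp2l// => /eqP mi; subst m.
  have x0 : eqmod i x 0.
    by apply/low => m mi; apply/negP => /mmin; rewrite leqNgt mi.
  have [/(low i.+1).2/(_ i (ltnSn i))|] := eqmodS_cases x0; first by rewrite dm.
  by rewrite add0r natrX.
have di : delta i x.
  have : ~ eqmod i.+1 x 0.
    by move=> /(eqmod_trans (eqmod_sym xi)); exact: neqmodX2.
  case: (boolP (delta i x)) => // di; case; apply/low => m.
  rewrite ltnS leq_eqVlt => /orP[/eqP -> //|]; move: m; apply/low.
  exact: eqmod_trans (eqmod_le (leqnSn i) xi) (eqmod_natX i).
rewrite /norm2; case: pselect => [e|[]]; last by exists i.
case: ex_minnP => m dm mmin; congr (_ ^- _).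
apply/eqP; rewrite eqn_leq mmin// leqNgt; apply/negP => mi.
have /low/(_ _ mi) : eqmod i x 0.
  exact: eqmod_trans (eqmod_le (leqnSn i) xi) (eqmod_natX i).
by rewrite dm.
Qed.

(** * Isometries of the 2-adic integers *)

(** This is [norm2 (f u - f v) = norm2 (u - v)]: a nonzero 2-adic leading digit
    can only be [1], so equality of norms is a congruence to one more digit. *)
Definition isometric_mod (f : Z2 -> Z2) :=
  forall k u v, eqmod k u v -> eqmod k.+1 (f u - f v) (u - v).

Section isometric.
Variable f : Z2 -> Z2.
Hypothesis isof : isometric_mod f.

Lemma isometric_iter n : isometric_mod (iter n f).
Proof.
elim: n => [|n IH] k u v uv /=; first exact: eqmod_refl.
apply: eqmod_trans (isof _) (IH _ _ _ uv).
apply/eqmod_subr0; apply: eqmod_trans (eqmod_le (leqnSn k) (IH _ _ _ uv)) _.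
exact/eqmod_subr0.
Qed.

Lemma isometric_eqmod k u v : eqmod k (f u) (f v) <-> eqmod k u v.
Proof.
split=> uv.
  elim: k uv => [_|k IH uv]; first exact: eqmod0.
  apply/eqmod_subr0; apply: eqmod_trans; last by apply/eqmod_subr0; exact: uv.
  exact/eqmod_sym/isof/IH/(eqmod_le (leqnSn k) uv).
case: k uv => [_|k uv]; first exact: eqmod0.
apply/eqmod_subr0; apply: eqmod_trans (isof (eqmod_le (leqnSn k) uv)) _.
exact/eqmod_subr0.
Qed.

Lemma isometric_compatible : compatible f.
Proof. by move=> r u v _ /isometric_eqmod. Qed.

(** Digits of a preimage are found one at a time: flipping digit [k] of [x]
    flips digit [k] of [f x] and leaves the lower digits alone. *)
Lemma isometric_onto k y : exists x, eqmod k (f x) y.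
Proof.
elim: k => [|k [x /eqmod_sym/eqmodS_cases[xy|xy]]].
- by exists 0; exact: eqmod0.
- by exists x; exact: eqmod_sym.
exists (x + 2%:R ^+ k); apply: eqmod_trans (eqmod_sym xy).
have xk : eqmod k (x + 2%:R ^+ k) x.
  by apply/eqmod_subr0; rewrite addrAC subrr add0r; exact: eqmod_natX.
have -> : f (x + 2%:R ^+ k) = f x + (f (x + 2%:R ^+ k) - f x) by ring.
apply: eqmodD (eqmod_refl _ _) _; apply: eqmod_trans (isof xk) _.
by rewrite addrAC subrr add0r; exact: eqmod_refl.
Qed.

End isometric.


(** * Reductions modulo powers of 2 *)

Lemma bijective_modP k f : compatible f -> (1 <= k)%N ->
  bijective_mod k f <-> forall y, exists x, eqmod k (f x) y.
Proof.
move=> cf k1; split=> [[g fg gf] y|surj].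
  exists (g (reduce k y) : nat)%:R; apply/eqmodE.
  by have /(congr1 val) := gf (reduce k y).
have /choice[g gP] : forall i : 'I_(2 ^ k),
    exists x, eqmod k (f x) (i : nat)%:R.
  by move=> i; exact: surj.
(* An injective section of a self-map of a finite set makes it bijective. *)
have gK : cancel (reduce k \o g) (induced_map f).
  move=> i /=; rewrite induced_reduce//; apply/val_inj => /=.
  by have /eqmodE -> := gP i; rewrite residue_nat modn_small.
exact: bij_can_bij (injF_bij (can_inj gK)) _ gK.
Qed.

Lemma bijective_mod_inj k f u v : compatible f -> (1 <= k)%N ->
  bijective_mod k f -> eqmod k (f u) (f v) -> eqmod k u v.
Proof.
move=> cf k1 /bij_inj fI /eqmodE fuv; apply/eqmodE.
suff /(congr1 val) : reduce k u = reduce k v by [].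
by apply: fI; rewrite !induced_reduce//; exact/val_inj.
Qed.

Lemma compatible_iter k f t u v : compatible f -> (1 <= k)%N ->
  eqmod k u v -> eqmod k (iter t f u) (iter t f v).
Proof. by move=> cf k1 uv; elim: t => //= t IH; exact: cf. Qed.

Lemma reduce_iter k f t x : compatible f -> (1 <= k)%N ->
  reduce k (iter t f x) = iter t (@induced_map k f) (reduce k x).
Proof. by move=> cf k1; elim: t => //= t IH; rewrite -induced_reduce// IH. Qed.

Lemma transitive_mod_orbit k f : compatible f -> (1 <= k)%N ->
  transitive_mod k f -> forall x y, exists t, eqmod k (iter t f x) y.
Proof.
move=> cf k1 [s sf /eqP/cards1P[C sC]] x y.
have inC z : porbit s z = C.
  by apply/set1P; rewrite -sC; apply: imset_f.
have : reduce k y \in porbit s (reduce k x).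
  by rewrite inC -(inC (reduce k y)) porbit_id.
move=> /porbitP[t yt]; exists t; apply/eqmodE.
suff /(congr1 val)/= : reduce k (iter t f x) = reduce k y by [].
by rewrite reduce_iter// yt permX; apply/esym/eq_iter.
Qed.

Lemma transitive_bijective_mod k m f : compatible f -> (1 <= k <= m)%N ->
  transitive_mod m f -> bijective_mod k f.
Proof.
move=> cf /andP[k1 km] tf; apply/bijective_modP => // y.
have [t ty] := transitive_mod_orbit cf (leq_trans k1 km) tf (f y) y.
by exists (iter t f y); rewrite -iterS iterSr; exact: eqmod_le km ty.
Qed.

(** * Digit series *)

(** Convergence in the 2-adic topology, spelled out on residues. *)
Definition digit_series (a : Z2) (a_ : nat -> Z2) (f : Z2 -> Z2) :=
  forall x k, exists N, forall n, (N <= n)%N ->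
    eqmod k (a + \sum_(0 <= i < n) a_ i * (delta i x)%:R) (f x).

Lemma cvg_digit_series a a_ f :
  (forall x : Z2,
     a + \sum_(0 <= i < n) a_ i * (delta i x)%:R @[n --> \oo] --> f x) ->
  digit_series a a_ f.
Proof.
move=> fS x k; have : nbhs (f x) (residue_class k (f x)).
  apply: open_nbhs_nbhs; split; last exact: eqmod_refl.
  by apply/Z2_openE => y yx; exists k => z zy; exact: eqmod_trans zy yx.
by move=> /fS[N _ SN]; exists N => n Nn; exact: SN.
Qed.

Lemma digit_series_trunc k a a_ f x : digit_series a a_ f ->
  (forall i, (k <= i)%N -> eqmod k (a_ i) 0) ->
  eqmod k (f x) (a + \sum_(0 <= i < k) a_ i * (delta i x)%:R).
Proof.
move=> fS ak; have [N /(_ _ (leq_addr k N))/eqmod_sym] := fS x k.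
move=> fx; apply: eqmod_trans fx _; apply: eqmodD (eqmod_refl _ _) _.
rewrite (big_cat_nat (n := k)) ?leq_addl//=.
rewrite -[X in eqmod _ _ X]addr0; apply: eqmodD (eqmod_refl _ _) _.
apply: (@eqmod_trans _ (\sum_(k <= i < N + k) 0)); last first.
  by rewrite big1//; exact: eqmod_refl.
rewrite big_nat [X in eqmod _ _ X]big_nat; apply: eqmod_sum => i /andP[ki _].
by rewrite -(mul0r (delta i x)%:R); apply: eqmodMr; exact: ak.
Qed.

Lemma delta0 i : delta i 0 = false.
Proof. by rewrite /delta /= mod0n div0n. Qed.

Lemma sum_delta0 k (a_ : nat -> Z2) :
  \sum_(0 <= i < k) a_ i * (delta i 0)%:R = 0.
Proof. by rewrite big1// => i _; rewrite delta0 mulr0. Qed.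

Lemma delta_X2 i j : delta i (2%:R ^+ j) = (i == j).
Proof.
rewrite /delta residue_X2; case: (ltngtP i j) => [ij|ji|->].
- by rewrite (eqP (dvdn_exp2l 2 ij)) div0n.
- by rewrite modn_small ?ltn_exp2l// ?(leq_trans ji)// divn_small// ltn_exp2l.
- by rewrite modn_small ?ltn_exp2l// divnn expn_gt0.
Qed.

Lemma digit_series_coef a a_ f j : digit_series a a_ f ->
  a_ j = f (2%:R ^+ j) - f 0.
Proof.
move=> fS; apply: Z2_eq => k; apply/eqmodE.
have [N0 /(_ _ (leq_maxl N0 j.+1))] := fS 0 k.
set n0 := maxn _ _; rewrite sum_delta0 addr0 => f0.
have [N1 /(_ _ (leq_maxl N1 j.+1))] := fS (2%:R ^+ j) k.
set n1 := maxn _ _; move=> f1.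
have -> : a_ j = (a + a_ j) - a by ring.
apply: eqmodB f0; apply: eqmod_trans f1.
rewrite big_mkord (bigD1 (Ordinal (leq_maxr N1 j.+1)))//= delta_X2 eqxx mulr1.
rewrite big1 ?addr0; first exact: eqmod_refl.
move=> i ij; rewrite delta_X2; have /negbTE -> : val i != j by [].
by rewrite mulr0.
Qed.

Section unit_coefficients.
Variables (a : Z2) (a_ : nat -> Z2) (f : Z2 -> Z2).
Hypothesis fS : digit_series a a_ f.
Hypothesis a_unit : forall i, eqmod i.+1 (a_ i) (2%:R ^+ i).

(** Digit [k] moves by [a_ k - 2^k = 0] modulo [2^(k+1)], so it drops out of the
    increment [f x - x]; the higher coefficients vanish already. *)
Lemma digit_series_drift k x :
  eqmod k.+1 (f x)
    (x + a + \sum_(0 <= i < k) (a_ i - 2%:R ^+ i) * (delta i x)%:R).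
Proof.
have ak i : (k.+1 <= i)%N -> eqmod k.+1 (a_ i) 0.
  move=> ki; apply: eqmod_le ki _.
  exact: eqmod_trans (eqmod_le (leqnSn i) (a_unit i)) (eqmod_natX i).
apply: eqmod_trans (digit_series_trunc x fS ak) _.
(* Regroup into the truncated series plus [x] minus its truncation below [2^k];
   modulo [2^(k+1)] the latter is [2^k * delta k x], like the last term of the
   series. *)
have -> : x + a + \sum_(0 <= i < k) (a_ i - 2%:R ^+ i) * (delta i x)%:R =
    x - \sum_(0 <= i < k) 2%:R ^+ i * (delta i x)%:R +
    (a + \sum_(0 <= i < k) a_ i * (delta i x)%:R).
  under eq_bigr do rewrite mulrBl.
  by rewrite sumrB; ring.
rewrite big_nat_recr//= addrA addrC; apply: eqmodD (eqmod_refl _ _).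
apply: eqmod_trans (eqmodMr _ (a_unit k)) _.
have -> : 2%:R ^+ k * (delta k x)%:R =
    \sum_(0 <= i < k.+1) 2%:R ^+ i * (delta i x)%:R -
    \sum_(0 <= i < k) 2%:R ^+ i * (delta i x)%:R :> Z2.
  by rewrite big_nat_recr//=; ring.
apply: eqmodB (eqmod_refl _ _); exact/eqmod_sym/eqmod_digits.
Qed.

Lemma digit_series_isometric : isometric_mod f.
Proof.
move=> k u v uv.
apply: eqmod_trans (eqmodB (digit_series_drift k u) (digit_series_drift k v)) _.
under eq_big_nat => i /andP[_ ik] do rewrite (eqmod_delta ik uv).
set s := \sum_(0 <= i < k) _.
have -> : u + a + s - (v + a + s) = u - v by ring.
exact: eqmod_refl.
Qed.

Let x_ t := iter t f 0.

Lemma digit_series_iter k t :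
  eqmod k.+1 (x_ t) (a *+ t + \sum_(0 <= i < k)
     (a_ i - 2%:R ^+ i) * (\sum_(0 <= s < t) delta i (x_ s))%:R).
Proof.
elim: t => [|t IH].
  rewrite big1 ?addr0; first exact: eqmod_refl.
  by move=> i _; rewrite big_geq// mulr0.
apply: eqmod_trans (digit_series_drift k (x_ t)) _.
under [X in eqmod _ _ (_ + X)]eq_bigr do rewrite big_nat_recr//= natrD mulrDr.
rewrite big_split/= [a *+ _]mulrS.
set d := \sum_(0 <= i < k) _ * (delta i _)%:R; set s := \sum_(0 <= i < k) _ * _.
have -> : a + a *+ t + (s + d) = a *+ t + s + a + d by ring.
by do 2!apply: eqmodD (eqmod_refl _ _).
Qed.

End unit_coefficients.

(** * The orbit of 0 *)

Lemma delta_shift k u v :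
  eqmod k.+1 v (u + 2%:R ^+ k) -> delta k v = ~~ delta k u.
Proof.
move=> vu; have vuk : eqmod k v u.
  rewrite -[u]addr0; apply: eqmod_trans (eqmod_le (leqnSn k) vu) _.
  exact: eqmodD (eqmod_refl _ _) (eqmod_natX k).
have : ~ eqmod k.+1 v u.
  move=> /eqmod_sym/eqmod_trans/(_ vu)/eqmod_subr0.
  rewrite opprD addrA subrr add0r => /eqmodN; rewrite opprK oppr0.
  exact: neqmodX2.
by rewrite eqmodS; case: (delta k v) (delta k u) => -[] // [].
Qed.

(** Digits are balanced along an orbit whose step [2^j] acts as [+ 2^j] modulo
    [2^(j+1)]: the second half of the first [2^(k+1)] terms repeats the digits
    below [k] of the first half and flips digit [k]. *)
Lemma count_digits (x_ : nat -> Z2) k i : (i <= k)%N ->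
  (forall j t, (j <= k)%N ->
    eqmod j.+1 (x_ (t + 2 ^ j)%N) (x_ t + 2%:R ^+ j)) ->
  (\sum_(0 <= t < 2 ^ k.+1) delta i (x_ t) = 2 ^ k)%N.
Proof.
have halves j (F : nat -> nat) : (\sum_(0 <= t < 2 ^ j.+1) F t =
    \sum_(0 <= t < 2 ^ j) (F t + F (t + 2 ^ j)))%N.
  rewrite expnS mul2n -addnn (big_cat_nat (n := 2 ^ j)) ?leq_addl//=.
  by rewrite -{2}[(2 ^ j)%N]add0n big_addn addnK big_split.
elim: k => [|k IH] ik shift; rewrite halves; last first.
  have [ik'|ki] := ltnP i k.+1; last first.
    have -> : i = k.+1 by apply/eqP; rewrite eqn_leq ik.
    under eq_bigr do
      rewrite (delta_shift (shift _ _ (leqnn _))) addnC addn_negb.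
    by rewrite sum_nat_const_nat subn0 muln1.
  under eq_bigr => t _.
    rewrite (@eqmod_delta k.+1 i _ (x_ t))//.
      over.
    rewrite -[X in eqmod _ _ X]addr0.
    apply: eqmod_trans (eqmod_le (leqnSn _) (shift _ _ (leqnn _))) _.
    exact: eqmodD (eqmod_refl _ _) (eqmod_natX _).
  rewrite big_split/= IH// => [|j t jk]; first by rewrite expnS mul2n addnn.
  exact/shift/leqW.
move: ik; rewrite leqn0 => /eqP ->.
under eq_bigr do rewrite (delta_shift (shift _ _ (leqnn _))) addnC addn_negb.
by rewrite sum_nat_const_nat subn0 muln1.
Qed.

Lemma isometric_orbit_shift f j t : isometric_mod f ->
  eqmod j.+1 (iter (2 ^ j) f 0) (2%:R ^+ j) ->
  eqmod j.+1 (iter (t + 2 ^ j) f 0) (iter t f 0 + 2%:R ^+ j).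
Proof.
move=> isof xj; rewrite iterD.
set y := iter (2 ^ j) f 0 in xj *.
have y0 : eqmod j y 0.
  exact: eqmod_trans (eqmod_le (leqnSn j) xj) (eqmod_natX j).
have := isometric_iter isof t y0; rewrite subr0 => /eqmod_trans/(_ xj) ty.
have -> : iter t f y = iter t f 0 + (iter t f y - iter t f 0) by ring.
exact: eqmodD (eqmod_refl _ _) ty.
Qed.

(** If two points of a class modulo [2^k] differ by [2^k], they represent both
    classes modulo [2^(k+1)] inside it, and [2^k] steps of [f] lead from one to
    the other. *)
Lemma isometric_orbit_onto f : isometric_mod f ->
  (forall j, eqmod j.+1 (iter (2 ^ j) f 0) (2%:R ^+ j)) ->
  forall k y, exists t, eqmod k (iter t f 0) y.
Proof.
move=> isof x2 k y; elim: k => [|k [t /eqmod_sym/eqmodS_cases[yt|yt]]].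
- by exists 0%N; exact: eqmod0.
- by exists t; exact: eqmod_sym.
exists (t + 2 ^ k)%N; apply: eqmod_trans (eqmod_sym yt).
exact: isometric_orbit_shift.
Qed.

(** By induction on [k]: the property below [k] balances the digits, so every
    drift term is a multiple of [4] times [2^(k-1)]. *)
Lemma digit_series_orbit_period a a_ f : digit_series a a_ f ->
  (forall i, eqmod i.+1 (a_ i) (2%:R ^+ i)) ->
  eqmod 1 a 1 -> eqmod 2 (a_ 0%N) 1 ->
  forall k, eqmod k.+1 (iter (2 ^ k) f 0) (2%:R ^+ k).
Proof.
move=> fS a_unit a1 a01; have isof := digit_series_isometric fS a_unit.
have a4 i : eqmod 2 (a_ i - 2%:R ^+ i) 0.
  apply/eqmod_subr0; case: i => [//|i]; exact: eqmod_le (a_unit _).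
elim/ltn_ind => k IH.
apply: eqmod_trans (digit_series_iter fS a_unit k (2 ^ k)) _.
rewrite -[X in eqmod _ _ X]addr0; apply: eqmodD.
  rewrite -[a *+ _]mulr_natl natrX -[X in eqmod _ _ X]mulr1 -addn1.
  exact: eqmod_mulX2.
case: k IH => [|k] IH; first by rewrite big_geq//; exact: eqmod_refl.
apply: (@eqmod_trans _ (\sum_(0 <= i < k.+1) 0)); last first.
  by rewrite big1//; exact: eqmod_refl.
rewrite big_nat [X in eqmod _ _ X]big_nat; apply: eqmod_sum => i /andP[_ ik].
rewrite (@count_digits (fun s => iter s f 0) k)// => [|j t jk]; last first.
  by apply: isometric_orbit_shift => //; exact: IH.
rewrite mulrC natrX -[X in eqmod _ _ X](mulr0 (2%:R ^+ k)).
by rewrite -(addn2 k); exact: eqmod_mulX2.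
Qed.

(** If [a] is even, the orbit of [0] stays even. If [a] is odd and [a_ 0 = 3]
    modulo [4], then [f (f 0) = 2 * a + (a_ 0 - 1) = 0] modulo [4]: modulo [4]
    the orbit consists of [0] and an odd number, so it misses [2]. *)
Lemma orbit_mod4_coefs a a_ f : digit_series a a_ f ->
  (forall i, eqmod i.+1 (a_ i) (2%:R ^+ i)) ->
  (forall y, exists t, eqmod 2 (iter t f 0) y) ->
  eqmod 1 a 1 /\ eqmod 2 (a_ 0%N) 1.
Proof.
move=> fS a_unit onto; have isof := digit_series_isometric fS a_unit.
have returns k m : (1 <= k)%N -> eqmod k (iter m f 0) 0 ->
    forall t, eqmod k (iter (t * m) f 0) 0.
  move=> k1 fm; elim=> [|t IH]; first exact: eqmod_refl.
  rewrite mulSn addnC iterD; apply: eqmod_trans IH.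
  exact: compatible_iter (isometric_compatible isof) k1 fm.
have f0 : eqmod 1 (f 0) a.
  by have := digit_series_drift fS a_unit 0 0; rewrite add0r big_geq// addr0.
have neq10 : ~ eqmod 1 1 0 by exact: (@neqmodX2 0).
have a1 : eqmod 1 a 1.
  have [a0|] := eqmodS_cases (eqmod0 a 0); last by rewrite add0r expr0.
  have [t /(eqmod_le (leqnSn 1)) t1] := onto 1.
  case: neq10; apply: eqmod_trans (eqmod_sym t1) _.
  by rewrite -[t]muln1; apply: returns => //; exact: eqmod_trans f0 a0.
split=> //.
have x2 : eqmod 2 (iter 2 f 0) (2%:R * a + (a_ 0%N - 1)).
  have := digit_series_iter fS a_unit 1 2.
  rewrite big_nat1 !big_nat_recr//= big_geq// add0n.
  have -> : delta 0 (f 0) = true.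
    by rewrite (eqmod_delta (ltnSn 0) (eqmod_trans f0 a1)).
  by rewrite add0n mulr1 expr0 mulr_natl.
have [//|a03] := eqmodS_cases (a_unit 0%N).
have {}x2 : eqmod 2 (iter 2 f 0) 0.
  apply: eqmod_trans x2 _; apply: (@eqmod_trans _ (2%:R * 1 + 2%:R)).
    apply: eqmodD; first exact: (eqmod_mulX2 1 a1).
    have -> : 2%:R = (1 + 2%:R) - 1 :> Z2 by ring.
    exact: eqmodB a03 (eqmod_refl _ _).
  by exists 1; ring.
have [t t2] := onto 2%:R.
have even : eqmod 1 (iter t f 0) 0.
  exact: eqmod_trans (eqmod_le (leqnSn 1) t2) (eqmod_natX 1).
case: (@neqmodX2 1); apply: eqmod_trans (eqmod_sym t2) _.
move: even; rewrite -(odd_double_half t); case: (odd t); last first.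
  by rewrite add0n -muln2 => _; exact: returns.
rewrite addSn add0n iterS => ev; case: neq10; apply: eqmod_trans ev.
apply: eqmod_trans (eqmod_sym (eqmod_trans f0 a1)) _.
apply/(isometric_eqmod isof)/eqmod_sym; rewrite -muln2.
exact: eqmod_le (leqnSn 1) (returns 2%N 2%N _ x2 _).
Qed.

(** The difference [a_ i = f (2^i) - f 0] vanishes modulo [2^i] by
    compatibility, but not modulo [2^(i+1)] by injectivity. *)
Lemma bijective_mod_coefs a a_ f : digit_series a a_ f -> compatible f ->
  (forall k, (1 <= k)%N -> bijective_mod k f) ->
  forall i, eqmod i.+1 (a_ i) (2%:R ^+ i).
Proof.
move=> fS cf bf i; rewrite (digit_series_coef i fS).
have : eqmod i (f (2%:R ^+ i) - f 0) 0.
  apply/eqmod_subr0; case: i => [|i]; first exact: eqmod0.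
  by apply: cf => //; exact: eqmod_natX.
move=> /eqmodS_cases[|]; last by rewrite add0r.
move=> /eqmod_subr0/bijective_mod_inj -/(_ cf isT (bf _ _)) h.
by case: (@neqmodX2 i); exact: h.
Qed.

(** * Sums of xors as digit series *)

(** For bits [c] and [b], [c xor b = b + (1 - 2 * b) * c]. *)
Lemma eqmod_xor2 n x b : eqmod n (xor2 x b)
  (b + \sum_(0 <= j < n)
     2%:R ^+ j * (1 - 2%:R * (delta j b)%:R) * (delta j x)%:R).
Proof.
apply: eqmod_trans (eqmod_digits n _) _.
apply: (@eqmod_trans _ (\sum_(0 <= j < n) 2%:R ^+ j * (delta j b)%:R +
  \sum_(0 <= j < n)
    2%:R ^+ j * (1 - 2%:R * (delta j b)%:R) * (delta j x)%:R)).
  rewrite -big_split/=; apply: eqmod_sum => j _; rewrite delta_xor2.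
  by case: (delta j x) (delta j b) => -[] /=; exists 0; ring.
by apply: eqmodD (eqmod_refl _ _); exact/eqmod_sym/eqmod_digits.
Qed.

Section xor_sum.
Variables (n : nat) (a : Z2) (a_ b_ : 'I_n -> Z2).
Let f x := a + \sum_(i < n) a_ i * xor2 x (b_ i).
Let sign_sum j := \sum_(i < n) a_ i * (1 - 2%:R * (delta j (b_ i))%:R).

Lemma xor_sum_digit_series : digit_series (a + \sum_(i < n) a_ i * b_ i)
  (fun j => 2%:R ^+ j * sign_sum j) f.
Proof.
move=> x k; exists k => m km; apply: eqmod_sym; apply: eqmod_le km _.
rewrite -addrA; apply: eqmodD (eqmod_refl _ _) _.
rewrite [X in eqmod _ _ X](_ : _ = \sum_(i < n) a_ i * (b_ i + \sum_(0 <= j < m)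
    2%:R ^+ j * (1 - 2%:R * (delta j (b_ i))%:R) * (delta j x)%:R)).
  by apply: eqmod_sum => i _; apply: eqmodMl; exact: eqmod_xor2.
under [RHS]eq_bigr do rewrite mulrDr mulr_sumr.
rewrite big_split/=; congr (_ + _); rewrite exchange_big/=.
apply: eq_bigr => j _.
by rewrite mulr_sumr mulr_suml; apply: eq_bigr => i _; ring.
Qed.

(** All sign sums have the parity of [\sum_i a_ i], because the signs are odd;
    that of [sign_sum 0 = f 1 - f 0] is odd by injectivity modulo [2]. *)
Lemma xor_sum_coefs : bijective_mod 1 f ->
  forall j, eqmod j.+1 (2%:R ^+ j * sign_sum j) (2%:R ^+ j).
Proof.
have sum_odd j : eqmod 1 (sign_sum j) (\sum_(i < n) a_ i).
  apply: eqmod_sum => i _; rewrite -[X in eqmod _ _ X]mulr1; apply: eqmodMl.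
  by exists (- (delta j (b_ i))%:R); ring.
have cf : compatible f by exact: compatible_xor_sum.
move=> bf j; rewrite -[X in eqmod _ _ X]mulr1 -addn1; apply: eqmod_mulX2.
apply: eqmod_trans (sum_odd j) _.
apply: eqmod_trans (eqmod_sym (sum_odd 0%N)) _.
have [s0|] := eqmodS_cases (eqmod0 (sign_sum 0) 0); last by rewrite add0r expr0.
have e := digit_series_coef 0 xor_sum_digit_series.
rewrite /= !expr0 mul1r in e.
move: s0; rewrite e => /eqmod_subr0/(bijective_mod_inj cf (leqnn 1) bf) h.
by case: (@neqmodX2 0).
Qed.

End xor_sum.

(** * Measures uniform on residue classes *)

Lemma eq_residue_class k x y :
  eqmod k x y -> residue_class k x = residue_class k y.
Proof.
move=> xy; apply/seteqP; split=> z zx; first exact: eqmod_trans zx xy.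
exact: eqmod_trans zx (eqmod_sym xy).
Qed.

Lemma residue_classS k x : residue_class k x =
  residue_class k.+1 x `|` residue_class k.+1 (x + 2%:R ^+ k).
Proof.
apply/seteqP; split=> y; first by move=> /eqmodS_cases[]; [left|right].
move=> [] /(eqmod_le (leqnSn k)) // yx; apply: eqmod_trans yx _.
rewrite -[X in eqmod _ _ X]addr0.
exact: eqmodD (eqmod_refl _ _) (eqmod_natX k).
Qed.

Lemma residue_classS_disj k x :
  residue_class k.+1 x `&` residue_class k.+1 (x + 2%:R ^+ k) = set0.
Proof.
rewrite -subset0 => y [yx yxk]; apply: (@neqmodX2 k).
have -> : 2%:R ^+ k = (x + 2%:R ^+ k) - x :> Z2 by ring.
exact/eqmod_subr0/(eqmod_trans (eqmod_sym yxk)).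
Qed.

Definition class_uniform (R : realType) (m : set Z2 -> \bar R) :=
  forall k x, m (residue_class k x) = m (residue_class k 0).

(** A class modulo [2^k] splits into two classes modulo [2^(k+1)], which share
    its mass equally. *)
Lemma class_uniformE (R : realType)
    (m : {finite_measure set Z2 -> \bar R}) k x :
  class_uniform m -> m (residue_class k x) = (m setT * (2%:R ^- k)%:E)%E.
Proof.
move=> mU; rewrite mU; elim: k => [|k IH].
  by rewrite residue_class0 expr0 invr1 mule1.
have mS := @measurable_residue_class k.+1.
have : m (residue_class k 0) =
    (m (residue_class k.+1 0%R) + m (residue_class k.+1 0%R))%E.
  rewrite -[in X in (_ + X)%E](mU _ (0 + 2%:R ^+ k)) residue_classS measureU//.
  exact: residue_classS_disj.
rewrite IH; have /fineK <- := fin_num_measure m _ (mS 0%R).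
have /fineK <- := fin_num_measure m _ measurableT.
set r := fine (m (residue_class _ _)); set t := fine (m setT).
rewrite -EFinD -!EFinM => -[e]; congr EFin.
have {}e : r *+ 2 = t * 2%:R ^- k by rewrite mulr2n.
by rewrite exprS invfM mulrCA -e -[r *+ 2]mulr_natl mulKf// pnatr_eq0.
Qed.

Lemma class_uniform_probability (R : realType) (mu : probability Z2 R) k x :
  class_uniform mu -> mu (residue_class k x) = (2%:R ^- k)%:E.
Proof.
move=> muU; rewrite (class_uniformE _ _ muU).
by rewrite -[RHS]mul1e; congr (_ * _)%E; exact: probability_setT.
Qed.

(** Haar measure is the only finite measure, up to its total mass, that charges
    all classes of each level equally: the classes form a pi-system that
    generates the measurable sets. *)
Lemma class_uniform_unique (R : realType)
    (m : {finite_measure set Z2 -> \bar R}) (mu : probability Z2 R) S :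
  class_uniform m -> class_uniform mu -> measurable S ->
  m S = (m setT * mu S)%E.
Proof.
move=> mU muU mS.
have mT : (fine (m setT))%:E = m setT.
  by rewrite fineK//; exact: fin_num_measure.
have ge0 : 0 <= fine (m setT) by apply: fine_ge0; exact: measure_ge0.
have -> : (m setT * mu S)%E = mscale (NngNum ge0) mu S by rewrite /mscale/= mT.
apply: (measure_unique residue_classes (fun=> setT)) => //.
- exact: Z2_measurableE.
- exact: residue_classesI.
- by move=> _; right; exists 0%N, 0; rewrite residue_class0.
- by rewrite bigcup_const.
- move=> A [->|[k [x ->]]]; first by rewrite !measure0.
  by rewrite /= /mscale/= mT class_uniformE// class_uniform_probability.
- by move=> _; rewrite -ge0_fin_numE//; exact: fin_num_measure.
Qed.

(** * Measure preservation and ergodicity *)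

Lemma measurable_compatible f : compatible f -> measurable_fun setT f.
Proof.
move=> cf; apply: measurable_fun_Z2 => k x.
apply: sub_sigma_algebra; apply/Z2_openE => y fy; exists k.+1 => z zy.
by apply: eqmod_trans fy; apply: eqmod_le (leqnSn k) _; exact: cf.
Qed.

Lemma isometric_preimage f k x : isometric_mod f ->
  f @^-1` residue_class k (f x) = residue_class k x.
Proof. by move=> isof; apply/seteqP; split=> y /(isometric_eqmod isof). Qed.

Section haar.
Variables (R : realType) (mu : probability Z2 R).
Hypothesis mu_haar : is_haar mu.

Lemma haar_class_uniform : class_uniform mu.
Proof.
move=> k x; rewrite -(mu_haar x (measurable_residue_class k 0)); congr (mu _).
apply/seteqP; split=> [z zx|_ [z z0 <-]].
  exists (z - x); last by rewrite addrC subrK.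
  exact/eqmod_subr0.
apply: (@eqmod_trans _ (x + 0)); first exact: eqmodD (eqmod_refl _ _) z0.
by rewrite addr0; exact: eqmod_refl.
Qed.

Lemma haar_class_gt0 k x : (0 < mu (residue_class k x))%E.
Proof.
rewrite class_uniform_probability; last exact: haar_class_uniform.
by rewrite lte_fin invr_gt0 exprn_gt0.
Qed.

(** The preimage of a class has positive measure, so it is not empty. *)
Lemma measure_preserving_bijective_mod k f : compatible f -> (1 <= k)%N ->
  measure_preserving mu f -> bijective_mod k f.
Proof.
move=> cf k1 [_ mp]; apply/bijective_modP => // y.
apply: contrapT => nx; have := haar_class_gt0 k y.
rewrite -mp; last exact: measurable_residue_class.
rewrite (_ : f @^-1` _ = set0) ?measure0 ?ltxx// -subset0 => x fx.
by apply: nx; exists x.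
Qed.

Lemma isometric_measure_preserving f :
  isometric_mod f -> measure_preserving mu f.
Proof.
move=> isof; have mf := measurable_compatible (isometric_compatible isof).
split=> // S mS.
pose F : {mfun Z2 >-> Z2} := HB.pack f (isMeasurableFun.Build _ _ _ _ _ mf).
have uF : class_uniform (distribution mu F).
  have im k y : distribution mu F (residue_class k y) = mu (residue_class k 0).
    have [x /eqmod_sym/eq_residue_class ->] := isometric_onto isof k y.
    rewrite -(haar_class_uniform k x) -(isometric_preimage k x isof).
    by [].
  by move=> k y; rewrite !im.
apply: etrans (class_uniform_unique uF haar_class_uniform mS) _.
rewrite -[RHS]mul1e; congr (_ * _)%E.
exact: (@probability_setT _ _ _ (distribution mu F)).
Qed.

(** For an invariant set [S], the part of [S] in the class of [x] is the
    preimage of the part in the class of [f x], so both have the same mass. As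
    the orbit of [0] meets all classes, the trace of [mu] on [S] is uniform on
    classes. *)
Lemma isometric_ergodic f : isometric_mod f ->
  (forall k y, exists t, eqmod k (iter t f 0) y) -> ergodic mu f.
Proof.
move=> isof onto; have mp := isometric_measure_preserving isof; split=> //.
move=> S mS fS.
have uS : class_uniform (mrestr mu mS).
  move=> k x; rewrite /mrestr.
  have [t /eqmod_sym/eq_residue_class ->] := onto k x.
  elim: t => [//|t IH]; rewrite -{}IH iterS.
  rewrite -(isometric_preimage k (iter t f 0) isof).
  rewrite -[in RHS]fS -preimage_setI mp.2//.
  by apply: measurableI => //; exact: measurable_residue_class.
have : mu S = (mu S * mu S)%E.
  rewrite -[in LHS](setIid S).
  apply: etrans (class_uniform_unique uS haar_class_uniform mS) _.
  by congr (mu _ * _)%E; exact: setTI.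
have /fineK <- := fin_num_measure mu _ mS.
rewrite -EFinM => -[]; set r := fine _ => e.
have /eqP : r * (r - 1) = 0 by rewrite mulrBr mulr1 -e subrr.
by rewrite mulf_eq0 subr_eq0 => /orP[] /eqP ->; [left|right].
Qed.

(** The classes in the cycle of [0] modulo [2^k] form an invariant set of
    positive, hence full, measure; a class outside it would be negligible. *)
Lemma ergodic_transitive_mod k f : compatible f -> (1 <= k)%N ->
  ergodic mu f -> transitive_mod k f.
Proof.
move=> cf k1 [mp erg].
have bf := measure_preserving_bijective_mod cf k1 mp.
pose s := perm (bij_inj bf).
have sE i : s i = induced_map f i by rewrite permE.
pose S := [set x | reduce k x \in porbit s (reduce k 0)].
have Sclass x y : eqmod k x y -> S x -> S y.
  move=> /eqmodE xy; rewrite /S/= (_ : reduce k x = reduce k y)//.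
  exact/val_inj.
have mS : measurable S.
  apply: sub_sigma_algebra; apply/Z2_openE => x Sx; exists k => y /eqmod_sym yx.
  exact: Sclass yx Sx.
have fS : f @^-1` S = S.
  apply/funext => x; rewrite /S/= -induced_reduce// -sE.
  by rewrite porbit_sym (porbit_perm s 1) porbit_sym.
have Scompl x : ~ S x -> residue_class k x `<=` ~` S.
  by move=> nSx y yx /(Sclass _ _ yx).
have ST : S = setT.
  apply/seteqP; split=> // x _; apply: contrapT => /Scompl nS.
  have [S0|S1] := erg S mS fS.
    have := haar_class_gt0 k 0; rewrite ltNge => /negP; apply.
    rewrite -S0; apply: le_measure; rewrite ?inE//.
      exact: measurable_residue_class.
    move=> y /eqmod_sym y0; apply: Sclass y0 _; exact: porbit_id.
  have := haar_class_gt0 k x; rewrite ltNge => /negP; apply.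
  have -> : 0%E = mu (~` S) by rewrite probability_setC// S1 subee.
  apply: le_measure; rewrite ?inE//; last exact: measurableC.
  exact: measurable_residue_class.
exists s => //; suff -> : porbits s = [set porbit s (reduce k 0)]%SET.
  by rewrite cards1.
apply/setP => C; rewrite inE; apply/imsetP/eqP => [[i _ ->]|->]; last first.
  by exists (reduce k 0).
apply/esym/eqP; rewrite eq_porbit_mem.
have : S (i : nat)%:R by rewrite ST.
rewrite /S/= (_ : reduce k _ = i) 1?porbit_sym//.
by apply/val_inj; rewrite /= residue_nat modn_small.
Qed.

End haar.

Theorem theorem5p1 (R : realType) (mu : probability Z2 R)
    (mu_haar : is_haar mu) :
  (forall (n : nat) (a : Z2) (a_ b_ : 'I_n -> Z2), (1 <= n)%N ->
    let f := fun x : Z2 => a + \sum_(i < n) a_ i * xor2 x (b_ i) in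
    (measure_preserving mu f <-> bijective_mod 1 f) /\
    (ergodic mu f <-> transitive_mod 2 f)) /\
  (forall (a : Z2) (a_ : nat -> Z2) (f : Z2 -> Z2),
    (forall x : Z2,
      a + \sum_(0 <= i < n) a_ i * (delta i x)%:R @[n --> \oo] --> f x) ->
    (compatible f /\ ergodic mu f <->
      [/\ eqmod 1 a 1, eqmod 2 (a_ 0%N) 1 &
          forall i : nat, (1 <= i)%N -> norm2 R (a_ i) = 2%:R ^- i]) /\
    (compatible f /\ measure_preserving mu f <->
      forall i : nat, norm2 R (a_ i) = 2%:R ^- i)).
Proof.
split=> [n a a_ b_ _ f|a a_ f /cvg_digit_series fS].
  have cf : compatible f by exact: compatible_xor_sum.
  have fS := xor_sum_digit_series a a_ b_.
  split; split.
  - exact: measure_preserving_bijective_mod.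
  - move=> /xor_sum_coefs a_unit; apply: isometric_measure_preserving => //.
    exact: digit_series_isometric fS a_unit.
  - exact: ergodic_transitive_mod.
  - move=> tf.
    have bf := transitive_bijective_mod cf (isT : (1 <= 1 <= 2)%N) tf.
    have a_unit := xor_sum_coefs bf.
    have isof := digit_series_isometric fS a_unit.
    have onto := transitive_mod_orbit cf (isT : (1 <= 2)%N) tf 0.
    have [a1 a01] := orbit_mod4_coefs fS a_unit onto.
    apply: isometric_ergodic => //; apply: isometric_orbit_onto => //.
    exact: digit_series_orbit_period fS a_unit a1 a01.
have coefs : compatible f -> measure_preserving mu f ->
    forall i, eqmod i.+1 (a_ i) (2%:R ^+ i).
  move=> cf mp; apply: (bijective_mod_coefs fS cf) => k k1.
  exact: (measure_preserving_bijective_mod mu_haar cf k1 mp).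
split; split.
- move=> [cf ef]; have a_unit := coefs cf ef.1.
  have tf := ergodic_transitive_mod mu_haar cf (isT : (1 <= 2)%N) ef.
  have onto := transitive_mod_orbit cf (isT : (1 <= 2)%N) tf 0.
  have [a1 a01] := orbit_mod4_coefs fS a_unit onto.
  by split=> // i _; exact/norm2P.
- move=> [a1 a01 an].
  have a_unit i : eqmod i.+1 (a_ i) (2%:R ^+ i).
    case: i => [|i]; first exact: eqmod_le (leqnSn 1) a01.
    by apply/norm2P; exact: an.
  have isof := digit_series_isometric fS a_unit.
  split; first exact: isometric_compatible.
  apply: isometric_ergodic => //; apply: isometric_orbit_onto => //.
  exact: digit_series_orbit_period fS a_unit a1 a01.
- by move=> [cf mp] i; apply/norm2P; exact: coefs.
- move=> an; have isof : isometric_mod f.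
    by apply: (digit_series_isometric fS) => i; exact/norm2P.
  split; [exact: isometric_compatible|exact: isometric_measure_preserving].
Qed.
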